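(* Let $(X,d)$ be a metric space. Then: (a) The following are equivalent: (i) the set $X$ is a singleton; (ii) the set $\mathcal{K}(X)$ is a singleton; (iii) the set $\mathcal{F}(X)$ is a singleton. (b) The following are equivalent: (i) the metric space $(X,d)$ has at least one isolated point; (ii) the metric space $(\mathcal{K}(X),d_H)$ has at least one isolated point; (iii) the metric space $(\mathcal{F}(X),d_\infty)$ has at least one isolated point; (iv) the metric space $(\mathcal{F}(X),d_0)$ has at least one isolated point; (v) the metric space $(\mathcal{F}(X),d_S)$ has at least one isolated point. (c) If the set $X$ is not a singleton, then the metric space $(\mathcal{F}(X),d_E)$ has no isolated points.
   Context: Write $\mathbb{I}=[0,1]$. For a metric space $(X,d)$, the Hausdorff distance between non-empty closed sets $C_1,C_2\subset X$ is $d_H(C_1,C_2)=\max\{\sup_{x_1\in C_1}d(x_1,C_2),\sup_{x_2\in C_2}d(x_2,C_1)\}$, where $d(x,C)=\inf_{c\in C}d(x,c)$. $\mathcal{K}(X)$ is the set of non-empty compact subsets of $X$, endowed with the metric $d_H$. Fuzzy sets: for $u:X\to\mathbb{I}$ set $u_\alpha=\{x: u(x)\ge\alpha\}$ for $\alpha\in(0,1]$ and $u_0=\overline{\{x:u(x)>0\}}$. $\mathcal{F}(X)$ (normal fuzzy sets) is the set of all upper-semicontinuous $u:X\to\mathbb{I}$ such that $u_0$ is compact and $u_1$ is non-empty. Metrics on $\mathcal{F}(X)$: the supremum metric $d_\infty(u,v)=\sup_{\alpha\in\mathbb{I}}d_H(u_\alpha,v_\alpha)$; the Skorokhod metric $d_0(u,v)$,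 the infimum of all $\varepsilon>0$ for which there is a strictly increasing homeomorphism $\xi:\mathbb{I}\to\mathbb{I}$ with $\sup_{\alpha\in\mathbb{I}}|\xi(\alpha)-\alpha|\le\varepsilon$ and $d_\infty(u,\xi\circ v)\le\varepsilon$. On $X\times\mathbb{I}$ put $\overline d((x,\alpha),(y,\beta))=\max\{d(x,y),|\alpha-\beta|\}$, with Hausdorff distance $\overline d_H$. Let $\mathrm{end}(u)=\{(x,\alpha)\in X\times\mathbb{I}: u(x)\ge\alpha\}$ and $\mathrm{send}(u)=\mathrm{end}(u)\cap(u_0\times\mathbb{I})$. The endograph metric is $d_E(u,v)=\overline d_H(\mathrm{end}(u),\mathrm{end}(v))$ and the sendograph metric is $d_S(u,v)=\overline d_H(\mathrm{send}(u),\mathrm{send}(v))$. *)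

(* Defs.v *)
From HB Require Import structures.
From mathcomp Require Import all_boot all_order all_algebra.
From mathcomp Require Import all_classical all_reals all_analysis.

Set Implicit Arguments.
Unset Strict Implicit.
Unset Printing Implicit Defensive.

Import Order.TTheory GRing.Theory Num.Theory.
Import numFieldNormedType.Exports.

Local Open Scope classical_set_scope.
Local Open Scope ring_scope.

Definition is_singleton (T : Type) (A : set T) : Prop := exists x, A = [set x].

(* Suprema and infima of distances are taken in the extended reals, so that
   no default value of a real [sup] or [inf] ever intervenes. *)
Section distances.
Context {R : realType} {T : Type}.
Implicit Types (d : T -> T -> R) (A B : set T).

Definition dist_to_set d (x : T) A : \bar R :=
  ereal_inf [set (d x a)%:E | a in A].

Definition hausdorff_dist d A B : \bar R :=
  Order.max (ereal_sup [set dist_to_set d a B | a in A])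
            (ereal_sup [set dist_to_set d b A | b in B]).

(* [x] is an isolated point of the metric space [(S, rho)]: some open ball
   centred at [x] is reduced to [x]. *)
Definition isolated_in (S : set T) (rho : T -> T -> \bar R) (x : T) : Prop :=
  S x /\ exists2 e : R, 0 < e & [set y | S y /\ (rho x y < e%:E)%E] = [set x].

End distances.

Section compact_subsets.
Context {R : realType} (X : metricType R).

Definition compact_sets : set (set X) := [set C | C !=set0 /\ compact C].

Definition dH : set X -> set X -> \bar R := hausdorff_dist (@mdist R X).

End compact_subsets.

Arguments compact_sets {R} X _.

Section fuzzy_sets.
Context {R : realType} {X : metricType R}.
Implicit Types u v : X -> R.

Definition level u (a : R) : set X :=
  if a == 0 then closure [set x | 0 < u x] else [set x | a <= u x].

Definition upper_semicontinuous u : Prop :=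
  forall x a, u x < a -> \forall y \near x, u y < a.

Definition fuzzy_dinfty u v : \bar R :=
  ereal_sup [set dH (level u a) (level v a) | a in `[0, 1]].

(* Self-homeomorphisms of [0, 1] are represented by functions on [R]; their
   values outside [0, 1] are irrelevant. *)
Definition increasing_homeo01 (xi : R -> R) : Prop :=
  [/\ set_bij `[0, 1] `[0, 1] xi,
      {in `[0, 1] &, {homo xi : a b / a < b}},
      {within `[0, 1], continuous xi} &
      exists2 zeta : R -> R, {in `[0, 1], cancel xi zeta} &
        {within `[0, 1], continuous zeta}].

Definition fuzzy_d0 u v : \bar R :=
  ereal_inf [set e%:E | e in [set e : R | 0 < e /\
    exists xi, [/\ increasing_homeo01 xi,
      (ereal_sup [set `|xi a - a|%:E | a in `[0%R, 1%R]] <= e%:E)%E &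
      (fuzzy_dinfty u (xi \o v) <= e%:E)%E]]].

(* X x [0, 1] is handled as a subset of X * R. *)
Definition dbar (p q : X * R) : R :=
  Order.max (mdist p.1 q.1) `|p.2 - q.2|.

Definition endograph u : set (X * R) :=
  [set p | 0 <= p.2 <= 1 /\ p.2 <= u p.1].

Definition sendograph u : set (X * R) :=
  endograph u `&` (level u 0 `*` `[0, 1]).

Definition fuzzy_dE u v : \bar R :=
  hausdorff_dist dbar (endograph u) (endograph v).

Definition fuzzy_dS u v : \bar R :=
  hausdorff_dist dbar (sendograph u) (sendograph v).

End fuzzy_sets.

Definition normal_fuzzy {R : realType} (X : metricType R) : set (X -> R) :=
  [set u | [/\ forall x, 0 <= u x <= 1, upper_semicontinuous u,
               compact (level u 0) & level u 1 !=set0]].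

Arguments normal_fuzzy {R} X _.

(* Main.v *)
Require Import Defs.
From mathcomp Require Import all_boot all_order all_algebra.
From mathcomp Require Import all_classical all_reals all_analysis.
From mathcomp Require Import lra.

(** Singletons embed [X] in the compact sets, and the indicator functions
[point p] embed it in the normal fuzzy sets. This gives part (a), and one half
of part (b): if no other point of [X] lies within [e] of [p], then a compact
set at distance less than [e] from [{p}] is [{p}], and a normal fuzzy set at
distance less than [e] from [point p], for any of the three metrics, is
positive at [p] only, hence equal to [point p] ([isolated_set1], [eq_point]).

For the other half of (b), suppose that [X] has no isolated point. Given a
compact [C] and [x] in [C], choose [y] distinct from [x] and very close to it.
If [y] is not in [C], add it to [C]; if it is, remove from [C] the open ball of
centre [x] and radius [mdist x y], every point of which is close to the
remaining point [y]. Either way [C] changes by little ([perturb_compact]). A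
normal fuzzy set [u] is treated alike, starting from a point [x] where
[u x = 1]: raise [u y] to 1, or put [u] to 0 on the ball ([perturb_fuzzy]).

That the new fuzzy set [v] is close to [u] is expressed by one relation that
mentions no level set: [dominated r u v] says that every value of [u] is
reached or exceeded by [v] within distance [r]. If it holds in both directions,
then [u] and [v] are close for the supremum metric ([dinfty_le]), hence for the
Skorokhod metric ([d0_le_dinfty]), and for the sendograph metric ([dS_le]). So
[exists_isolated_fuzzy] deals with the three metrics at once.

The endograph metric is weaker still: it is bounded by the uniform distance
([dE_le]). If [X] has two points, a value of [u] can be changed slightly while
[u] keeps the value 1 at another point, so no [u] is isolated
([perturb_endograph]), whatever the isolated points of [X]. *)

Local Open Scope classical_set_scope.

Section isolated_points.
Set Implicit Arguments.
Unset Strict Implicit.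
Import Order.TTheory GRing.Theory Num.Theory.
Import numFieldNormedType.Exports.
Local Open Scope ring_scope.

(** * Hausdorff distances and isolated points *)

Section distances.
Context {R : realType} {T : Type}.
Implicit Types (d : T -> T -> R) (A B : set T) (e : R).

Lemma hausdorff_dist_le d A B e :
    (forall a, A a -> exists2 b, B b & d a b <= e) ->
    (forall b, B b -> exists2 a, A a & d b a <= e) ->
  (hausdorff_dist d A B <= e%:E)%E.
Proof.
move=> AB BA; rewrite /hausdorff_dist ge_max; apply/andP; split;
  apply: ge_ereal_sup => _ [a Aa <-].
- have [b Bb ab] := AB _ Aa.
  by apply: (@le_trans _ _ (d a b)%:E); [apply: ereal_inf_lbound; exists b|].
- have [b Bb ab] := BA _ Aa.
  by apply: (@le_trans _ _ (d a b)%:E); [apply: ereal_inf_lbound; exists b|].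
Qed.

Lemma hausdorff_dist_lt d A B e b :
  (hausdorff_dist d A B < e%:E)%E -> B b -> exists2 a, A a & d b a < e.
Proof.
rewrite /hausdorff_dist gt_max => /andP[_ supB] Bb.
have : (dist_to_set d b A < e%:E)%E.
  by apply: le_lt_trans supB; apply: ereal_sup_ubound; exists b.
by move=> /ereal_inf_lt[_ [a Aa <-]]; rewrite lte_fin => dba; exists a.
Qed.

Lemma isolated_in_intro (S : set T) (rho : T -> T -> \bar R) x e :
    S x -> 0 < e -> (rho x x < e%:E)%E ->
    (forall y, S y -> (rho x y < e%:E)%E -> y = x) ->
  isolated_in S rho x.
Proof.
move=> Sx e0 xx xP; split=> //; exists e => //.
by apply/seteqP; split=> [y [Sy xy]|_ ->]; [exact: xP|split].
Qed.

Lemma not_isolated_in (S : set T) (rho : T -> T -> \bar R) x :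
    (forall e, 0 < e -> exists y, [/\ S y, y <> x & (rho x y <= e%:E)%E]) ->
  ~ isolated_in S rho x.
Proof.
move=> xP [Sx [e e0 xe]].
have /xP[y [Sy yx xy]] : 0 < e / 2 by rewrite divr_gt0.
apply: yx; suff : [set x] y by [].
rewrite -xe; split=> //; apply: le_lt_trans xy _; rewrite lte_fin; lra.
Qed.

End distances.

(** * Points and compact sets of a metric space *)

Section metric_space.
Context {R : realType} (X : metricType R).
Implicit Types (x y z p : X) (C : set X) (u v w : X -> R).

Lemma open_mdist_lt x (r : R) : open [set z | mdist x z < r].
Proof.
rewrite openE => z /= xz; apply/nbhs_ballP; exists (r - mdist x z) => /=.
  by rewrite subr_gt0.
move=> t; rewrite ballEmdist /= => zt.
have := metric_triangle x z t; lra.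
Qed.

Lemma closed_point x : closed [set x].
Proof. exact/accessible_closed_set1/hausdorff_accessible/metric_hausdorff. Qed.

Lemma isolatedP x :
  isolated [set: X] x <->
  exists2 e : R, 0 < e & forall y, mdist x y < e -> y = x.
Proof.
split=> [[_ [V /nbhs_ballP[e /= e0 eV]]]|[e e0 xe]].
  rewrite setIT => Vx; exists e => // y xy.
  by have : V y; [apply: eV; rewrite ballEmdist|rewrite Vx].
split; first by rewrite inE.
exists (ball x e); first exact: nbhsx_ballx.
rewrite setIT ballEmdist; apply/seteqP; split=> [y /= /xe //|_ ->] /=.
by rewrite mdistxx.
Qed.

Lemma not_isolated_near x (e : R) : ~ isolated [set: X] x -> 0 < e ->
  exists2 y, y != x & mdist x y < e.
Proof.
move=> xN e0; apply: contrapT => yN; apply: xN; apply/isolatedP.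
exists e => // y xy; apply/eqP; apply: contrapT => /negP yx.
by apply: yN; exists y.
Qed.

Lemma dH_self C (e : R) : 0 < e -> (dH C C < e%:E)%E.
Proof.
move=> e0; apply: (@le_lt_trans _ _ 0%:E); last by rewrite lte_fin.
by apply: hausdorff_dist_le => a Ca; exists a; rewrite ?mdistxx.
Qed.

Lemma isolated_set1 x : isolated [set: X] x ->
  isolated_in (compact_sets X) (@dH _ X) [set x].
Proof.
move=> /isolatedP[e e0 xe]; apply: (@isolated_in_intro _ _ _ _ _ e) => //.
- by split; [exists x|exact: compact_set1].
- exact: dH_self.
- move=> C [[c Cc] _] xC.
  have CP z : C z -> z = x.
    move=> Cz; have [_ -> zx] := hausdorff_dist_lt xC Cz.
    by apply: xe; rewrite metric_sym.
  by apply/seteqP; split=> [z /CP //|_ ->]; rewrite -(CP c).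
Qed.

Lemma perturb_compact C (e : R) : (forall x, ~ isolated [set: X] x) ->
    compact_sets X C -> 0 < e ->
  exists D, [/\ compact_sets X D, D <> C & (dH C D <= e%:E)%E].
Proof.
move=> Xperf [[x Cx] Cco] e0.
have [||y yx xy] := @not_isolated_near x (e / 2); [exact: Xperf|lra|].
have dyx := metric_sym y x.
have r0 := mdist_ge0 x y.
have [Cy|Cy] := pselect (C y).
- exists (C `\` [set z | mdist x z < mdist x y]); split.
  + split; first by exists y; split=> //=; rewrite ltxx.
    apply: (subclosed_compact _ Cco); last by move=> z [].
    apply: closedI; last exact/open_closedC/open_mdist_lt.
    exact: (compact_closed (@metric_hausdorff _ X)).
  + move=> DC; have : C x by [].
    by rewrite -DC => -[_ /=]; apply; rewrite mdistxx mdist_gt0 eq_sym.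
  + apply: hausdorff_dist_le => [a Ca|b [Cb _]]; last first.
      by exists b => //; rewrite mdistxx ltW.
    have [xa|xa] := ltP (mdist x a) (mdist x y); last first.
      by exists a; [split=> //=; rewrite ltNge xa|rewrite mdistxx ltW].
    exists y; first by split=> //=; rewrite ltxx.
    have := metric_triangle a x y; rewrite (metric_sym a x); lra.
- exists (C `|` [set y]); split.
  + split; first by exists x; left.
    by apply: compactU => //; exact: compact_set1.
  + by move=> DC; apply: Cy; rewrite -DC; right.
  + apply: hausdorff_dist_le => [a Ca|b [Cb|->]].
    * by exists a; [left|rewrite mdistxx ltW].
    * by exists b => //; rewrite mdistxx ltW.
    * exists x => //; lra.
Qed.

Lemma exists_isolated_compact :
  (exists C, isolated_in (compact_sets X) (@dH _ X) C) <->
  exists x, isolated [set: X] x.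
Proof.
split=> [[C Ciso]|[x /isolated_set1 xiso]]; last by exists [set x].
apply: contrapT => Xperf; have KC := Ciso.1.
apply: not_isolated_in Ciso => e; apply: perturb_compact KC => x xiso.
by apply: Xperf; exists x.
Qed.

(** * Level sets and elementary normal fuzzy sets *)

Lemma level0E u : level u 0 = closure [set x | 0 < u x].
Proof. by rewrite /level eqxx. Qed.

Lemma level_gt0E u (a : R) : 0 < a -> level u a = [set x | a <= u x].
Proof. by move=> a0; rewrite /level gt_eqF. Qed.

Lemma level0_gt0 u x : 0 < u x -> level u 0 x.
Proof. by rewrite level0E => ux; exact: subset_closure. Qed.

Lemma normal_fuzzyP u : normal_fuzzy X u <->
  [/\ forall x, 0 <= u x <= 1, upper_semicontinuous u,
      compact (level u 0) & exists x, u x = 1].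
Proof.
split=> [[u01 uusc uco [x ux]]|[u01 uusc uco [x ux]]]; split=> //; exists x.
  move: ux; rewrite level_gt0E//= => ux; apply/eqP; rewrite eq_le ux andbT.
  by have /andP[] := u01 x.
by rewrite level_gt0E//= ux.
Qed.

(** The support enters compactness only through its closure, so shrinking the
support keeps it compact. *)
Lemma compact_level0 u v : compact (level u 0) ->
  (forall x, 0 < v x -> 0 < u x) -> compact (level v 0).
Proof.
move=> uco vu; apply: subclosed_compact uco _.
  by rewrite level0E; exact: closed_closure.
by rewrite !level0E; apply: closureS => x /vu.
Qed.

Definition raise w p (c : R) : X -> R := fun x => if x == p then c else w x.

Lemma raise_same w p c : raise w p c p = c.
Proof. by rewrite /raise eqxx. Qed.

Lemma raise_other w p c x : x != p -> raise w p c x = w x.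
Proof. by rewrite /raise => /negbTE ->. Qed.

(** A neighbourhood of any other point avoids [p], since points are closed; at
[p] itself only an upward change is harmless, whence [w p <= c]. *)
Lemma usc_raise w p c : upper_semicontinuous w -> w p <= c ->
  upper_semicontinuous (raise w p c).
Proof.
move=> wusc wpc x a; have [->|xp] := eqVneq x p.
  rewrite raise_same => ca; near=> y; rewrite /raise; case: eqP => // _.
  near: y; apply: wusc; exact: le_lt_trans ca.
rewrite raise_other// => wxa; near=> y; rewrite raise_other.
  by near: y; exact: wusc.
near: y; have : open (~` [set p]) by apply: closed_openC; exact: closed_point.
by rewrite openE => /(_ x)/(_ (elimN eqP xp)); apply: filterS => y /eqP.
Unshelve. all: by end_near. Qed.

Lemma normal_raise w p c : (forall x, 0 <= w x <= 1) ->
    upper_semicontinuous w -> compact (level w 0) ->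
    w p <= c <= 1 -> (exists x, raise w p c x = 1) ->
  normal_fuzzy X (raise w p c).
Proof.
move=> w01 wusc wco /andP[wpc c1] v1; apply/normal_fuzzyP; split=> //.
- move=> x; rewrite /raise; case: eqP => // _; rewrite c1 andbT.
  by apply: le_trans wpc; have /andP[] := w01 p.
- exact: usc_raise.
- apply: (@subclosed_compact _ _ (level w 0 `|` [set p])).
  + by rewrite level0E; exact: closed_closure.
  + by apply: compactU => //; exact: compact_set1.
  + have /closure_id -> := @closed_point p; rewrite !level0E -closureU.
    apply: closureS => x /=; rewrite /raise; case: eqP => [|_]; first by right.
    by left.
Qed.

Definition point p : X -> R := raise (fun=> 0) p 1.

Lemma normal_point p : normal_fuzzy X (point p).
Proof.
apply: normal_raise.
- by move=> x; rewrite lexx ler01.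
- by move=> x a x0; near=> y.
- rewrite level0E [X in closure X](_ : _ = set0) ?closure0.
    exact: compact0.
  by rewrite -subset0 => x /=; rewrite ltxx.
- by rewrite ler01 lexx.
- by exists p; rewrite raise_same.
Unshelve. all: by end_near. Qed.

Lemma point_gt0 p x : 0 < point p x -> x = p.
Proof. by rewrite /point /raise; case: eqP => //; rewrite ltxx. Qed.

Lemma level0_point p : level (point p) 0 = [set p].
Proof.
have /closure_id -> := @closed_point p; rewrite level0E; congr closure.
apply/seteqP; split=> [x /point_gt0 //|_ ->] /=.
by rewrite /point raise_same.
Qed.

(** Normality fixes the value at [p]: the value 1 is attained somewhere, and
[p] is the only possible place. *)
Lemma eq_point p v : normal_fuzzy X v -> (forall y, 0 < v y -> y = p) ->
  v = point p.
Proof.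
move=> /normal_fuzzyP[v01 _ _ [x vx]] vP; apply/funext => y.
have xp : x = p by apply: vP; rewrite vx.
rewrite /point /raise; case: eqP => [->|yp]; first by rewrite -xp.
apply/eqP; rewrite eq_le; have /andP[-> _] := v01 y; rewrite andbT leNgt.
by apply/negP => /vP.
Qed.

(** * Distances between fuzzy sets that dominate each other *)

Definition dominated (r : R) u v :=
  forall x, 0 < u x -> exists2 y, u x <= v y & mdist x y <= r.

Lemma dominated_refl (r : R) u : 0 <= r -> dominated r u u.
Proof. by move=> r0 x _; exists x; rewrite ?mdistxx. Qed.

(** Passing to the closure costs an arbitrarily small amount, whence [e]
strictly larger than [r]. *)
Lemma dominated_level0 (r e : R) u v x : dominated r u v -> r < e ->
  level u 0 x -> exists2 y, level v 0 y & mdist x y <= e.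
Proof.
move=> uv re; rewrite level0E => ux.
have /ux[z [/= uz]] : nbhs x (ball x (e - r)).
  by apply: nbhsx_ballx; rewrite subr_gt0.
rewrite ballEmdist /= => xz; have [y uvy zy] := uv z uz.
exists y; first by apply: level0_gt0; apply: lt_le_trans uvy.
have := metric_triangle x z y; lra.
Qed.

(** A single domination handles all levels [a]: if [a <= u x] and the value
[u x] is reached by [v] at [y], then [a <= v y]. *)
Lemma dominated_level (r e a : R) u v x : dominated r u v -> r < e -> 0 <= a ->
  level u a x -> exists2 y, level v a y & mdist x y <= e.
Proof.
move=> uv re; rewrite le_eqVlt => /orP[/eqP <-|a0].
  exact: dominated_level0 re.
rewrite !level_gt0E//= => aux.
have [y uvy xy] := uv x (lt_le_trans a0 aux).
by exists y; [exact: le_trans uvy|rewrite (le_trans xy)// ltW].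
Qed.

Lemma dinfty_le (r e : R) u v : dominated r u v -> dominated r v u -> r < e ->
  (fuzzy_dinfty u v <= e%:E)%E.
Proof.
move=> uv vu re; apply: ge_ereal_sup => _ [a a01 <-].
move: a01; rewrite /= in_itv/= => /andP[a0 _].
by apply: hausdorff_dist_le => x; apply: dominated_level re a0.
Qed.

Lemma increasing_homeo01_id : increasing_homeo01 (@id R).
Proof.
have id_cont : {within `[0, 1], continuous (@id R)}.
  by apply: continuous_subspaceT => x; exact: cvg_id.
split=> //; last by exists id.
by split=> // x; exists x.
Qed.

Lemma d0_le_dinfty (e : R) u v : 0 < e -> (fuzzy_dinfty u v <= e%:E)%E ->
  (fuzzy_d0 u v <= e%:E)%E.
Proof.
move=> e0 uv; apply: ereal_inf_lbound; exists e => //; split=> //.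
exists id; split=> //; first exact: increasing_homeo01_id.
by apply: ge_ereal_sup => _ [a _ <-]; rewrite subrr normr0 lee_fin ltW.
Qed.

Lemma sendograph_level u x (a : R) : sendograph u (x, a) <->
  [/\ 0 <= a <= 1, a <= u x & level u 0 x].
Proof.
split=> [[[/= a01 au] [/= ux _]]|[a01 au ux]]; first by split.
by split; split=> //=; rewrite in_itv.
Qed.

(** The point [(x, a)] is matched with [(y, a)] at the same height. At height 0
the point [x] may lie in the closure of the support only, and [y] comes from
the closure of the other support. *)
Lemma dominated_sendograph (r e : R) u v (p : X * R) : (forall x, 0 <= v x) ->
    dominated r u v -> r < e ->
  sendograph u p -> exists2 q, sendograph v q & dbar p q <= e.
Proof.
case: p => x a v0 uv re /sendograph_level[/andP[a0 a1] aux ux].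
have d_le y : mdist x y <= e -> dbar (x, a) (y, a) <= e.
  move=> xy; rewrite /dbar /= subrr normr0 ge_max xy /=.
  by apply: le_trans xy; exact: mdist_ge0.
move: a0; rewrite le_eqVlt => /orP[/eqP a0|a0].
  have [y vy xy] := dominated_level0 uv re ux.
  exists (y, a); last exact: d_le.
  by apply/sendograph_level; rewrite a1 -a0 lexx; split.
have [y uvy xy] := uv x (lt_le_trans a0 aux).
have avy := le_trans aux uvy.
exists (y, a); last by apply: d_le; rewrite (le_trans xy)// ltW.
apply/sendograph_level; split=> //; first by rewrite a1 ltW.
by apply: level0_gt0; apply: lt_le_trans avy.
Qed.

Lemma dS_le (r e : R) u v : (forall x, 0 <= u x) -> (forall x, 0 <= v x) ->
    dominated r u v -> dominated r v u -> r < e ->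
  (fuzzy_dS u v <= e%:E)%E.
Proof.
move=> u0 v0 uv vu re.
by apply: hausdorff_dist_le => p; apply: dominated_sendograph re.
Qed.

(** * Fuzzy sets near an indicator function *)

(** The level 0 alone controls the support of [v]. *)
Lemma dinfty_lt_point p v (e : R) y : (fuzzy_dinfty (point p) v < e%:E)%E ->
  0 < v y -> mdist p y < e.
Proof.
move=> pv vy.
have H : (dH (level (point p) 0) (level v 0) < e%:E)%E.
  apply: le_lt_trans pv; apply: ereal_sup_ubound; exists 0 => //=.
  by rewrite in_itv/= lexx ler01.
have [q] := hausdorff_dist_lt H (level0_gt0 vy).
by rewrite level0_point => ->; rewrite metric_sym.
Qed.

(** A change of heights [xi] is increasing with [0 <= xi 0], so it preserves
the support and the bound for the supremum metric applies to [xi \o v]. *)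
Lemma d0_lt_point p v (e : R) y : (forall x, 0 <= v x <= 1) ->
  (fuzzy_d0 (point p) v < e%:E)%E -> 0 < v y -> mdist p y < e.
Proof.
move=> v01 /ereal_inf_lt[_ [r [r0 [xi [[xibij xiinc _ _] _ pv]]] <-]] re vy.
apply: (dinfty_lt_point (le_lt_trans pv re)) => /=.
have I0 : (0 : R) \in `[0, 1] by rewrite in_itv/= lexx ler01.
have [xifun _ _] := xibij.
have : `[0, 1]%classic (xi 0) by exact: xifun.
rewrite /= in_itv/= => /andP[xi0 _]; apply: le_lt_trans xi0 _.
by apply: xiinc => //; rewrite in_itv; exact: v01.
Qed.

Lemma dS_lt_point p v (e : R) y : (forall x, 0 <= v x <= 1) ->
  (fuzzy_dS (point p) v < e%:E)%E -> 0 < v y -> mdist p y < e.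
Proof.
move=> v01 pv vy.
have vyy : sendograph v (y, v y).
  by apply/sendograph_level; split=> //; exact: level0_gt0.
have [[q a] /sendograph_level[_ _]] := hausdorff_dist_lt pv vyy.
by rewrite level0_point /dbar gt_max /= => -> /andP[+ _]; rewrite metric_sym.
Qed.

(** * Isolated points for the supremum, Skorokhod and sendograph metrics *)

Definition erase u x (r : R) : X -> R :=
  fun z => if mdist x z < r then 0 else u z.

(** The ball is open, so erasing keeps upper semicontinuity; [y] lies outside
the ball and preserves normality. *)
Lemma normal_erase u x r y : normal_fuzzy X u -> u y = 1 -> r <= mdist x y ->
  normal_fuzzy X (erase u x r).
Proof.
move=> /normal_fuzzyP[u01 uusc uco _] uy ry.
have erase_le z : erase u x r z <= u z.
  by rewrite /erase; case: ifP => // _; have /andP[] := u01 z.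
apply/normal_fuzzyP; split.
- by move=> z; rewrite /erase; case: ifP; rewrite // lexx ler01.
- move=> z a; rewrite {1}/erase; case: ifPn => [xz a0|_ uza].
    have := open_mdist_lt x r; rewrite openE => /(_ z xz).
    by apply: filterS => t /= xt; rewrite /erase xt.
  by apply: filterS (uusc z a uza) => t; exact: le_lt_trans.
- by apply: compact_level0 uco _ => z /lt_le_trans; apply.
- by exists y; rewrite /erase ltNge ry.
Qed.

Lemma perturb_fuzzy u (e : R) : (forall x, ~ isolated [set: X] x) ->
    normal_fuzzy X u -> 0 < e ->
  exists v, [/\ normal_fuzzy X v, v <> u &
    exists r, [/\ 0 <= r, r < e, dominated r u v & dominated r v u]].
Proof.
move=> Xperf Fu e0; have /normal_fuzzyP[u01 uusc uco [x ux]] := Fu.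
have u_le1 z : u z <= 1 by have /andP[] := u01 z.
have [||y yx xy] := @not_isolated_near x (e / 2); [exact: Xperf|lra|].
have d0 := mdist_ge0 x y.
(* A point of the erased ball is within [mdist x y] of [x], hence within
   [r] of [y]. *)
pose r := mdist x y + mdist x y; have r0 : 0 <= r by rewrite /r; lra.
have [uy|uy] := eqVneq (u y) 1.
- exists (erase u x (mdist x y)); split; first exact: normal_erase uy _.
    move=> /(congr1 (@^~ x)); rewrite /erase mdistxx mdist_gt0 eq_sym yx ux.
    by move=> /esym/eqP; rewrite oner_eq0.
  exists r; split=> //; first by rewrite /r; lra.
    move=> z uz; have [xz|xz] := ltP (mdist x z) (mdist x y).
      exists y; first by rewrite /erase ltxx uy.
      have := metric_triangle z x y; rewrite (metric_sym z x) /r; lra.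
    by exists z; rewrite ?mdistxx// /erase ltNge xz.
  move=> z; rewrite /erase; case: ifP => [|_ uz]; first by rewrite ltxx.
  by exists z; rewrite ?mdistxx.
- exists (raise u y 1); split.
  + apply: normal_raise => //; first by rewrite u_le1 lexx.
    by exists y; rewrite raise_same.
  + move=> /(congr1 (@^~ y)); rewrite raise_same => /esym uy1.
    by rewrite uy1 eqxx in uy.
  + exists r; split=> //; first by rewrite /r; lra.
      move=> z uz; exists z; rewrite ?mdistxx// /raise.
      by case: eqP => // ->.
    move=> z; rewrite /raise; case: eqP => [-> _|_ uz].
      by exists x; rewrite ?ux// metric_sym /r; lra.
    by exists z; rewrite ?mdistxx.
Qed.

(** The common form of the equivalence for the three metrics: [rho] must be
small between fuzzy sets that dominate each other, and must separate [point p]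
from the fuzzy sets with points far from [p] in their support. *)
Lemma exists_isolated_fuzzy (rho : (X -> R) -> (X -> R) -> \bar R) :
    (forall (r e : R) u v, normal_fuzzy X u -> normal_fuzzy X v ->
       0 <= r -> r < e -> dominated r u v -> dominated r v u ->
       (rho u v <= e%:E)%E) ->
    (forall p v (e : R) y, normal_fuzzy X v -> (rho (point p) v < e%:E)%E ->
       0 < v y -> mdist p y < e) ->
  (exists u, isolated_in (normal_fuzzy X) rho u) <->
  exists x, isolated [set: X] x.
Proof.
move=> rho_le rho_point; split=> [[u uiso]|[p /isolatedP[e e0 pe]]].
  apply: contrapT => Xperf; have Fu := uiso.1.
  apply: not_isolated_in uiso => e e0.
  have [|v [Fv vu [r [r0 re uv vu']]]] := perturb_fuzzy _ Fu e0.
    by move=> x xiso; apply: Xperf; exists x.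
  by exists v; split=> //; exact: rho_le re uv vu'.
exists (point p); apply: (@isolated_in_intro _ _ _ _ _ e) => //.
- exact: normal_point.
- apply: (@le_lt_trans _ _ (e / 2)%:E); last by rewrite lte_fin; lra.
  by apply: (rho_le 0) => //;
    [exact: normal_point|exact: normal_point|lra|exact: dominated_refl..].
- move=> v Fv pv; apply: eq_point => // y vy.
  by apply: pe; exact: rho_point pv vy.
Qed.

Lemma exists_isolated_dinfty :
  (exists u, isolated_in (normal_fuzzy X) fuzzy_dinfty u) <->
  exists x, isolated [set: X] x.
Proof.
apply: exists_isolated_fuzzy => [r e u v _ _ _ re uv vu|p v e y _].
  exact: dinfty_le re.
exact: dinfty_lt_point.
Qed.

Lemma exists_isolated_d0 :
  (exists u, isolated_in (normal_fuzzy X) fuzzy_d0 u) <->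
  exists x, isolated [set: X] x.
Proof.
apply: exists_isolated_fuzzy => [r e u v _ _ r0 re uv vu|p v e y [v01 _ _ _]].
  apply: d0_le_dinfty; first exact: le_lt_trans re.
  exact: dinfty_le re.
exact: d0_lt_point.
Qed.

Lemma exists_isolated_dS :
  (exists u, isolated_in (normal_fuzzy X) fuzzy_dS u) <->
  exists x, isolated [set: X] x.
Proof.
apply: exists_isolated_fuzzy => [r e u v [u01 _ _ _] [v01 _ _ _] _ re uv vu|].
  by apply: dS_le re => // x; [have /andP[] := u01 x|have /andP[] := v01 x].
by move=> p v e y [v01 _ _ _]; exact: dS_lt_point.
Qed.

(** * The endograph metric *)

(** A point [(x, a)] of one endograph is lowered vertically to the other one,
at height [Num.min a (v x)]; the height 0 is always available. *)
Lemma dE_le (e : R) u v : (forall x, 0 <= u x) -> (forall x, 0 <= v x) ->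
  (forall x, `|u x - v x| <= e) -> (fuzzy_dE u v <= e%:E)%E.
Proof.
suff H w w' (p : X * R) :
    (forall x, 0 <= w' x) -> (forall x, `|w x - w' x| <= e) ->
    endograph w p -> exists2 q, endograph w' q & dbar p q <= e.
  move=> u0 v0 uv; apply: hausdorff_dist_le => p; apply: H => // x.
  by rewrite distrC.
case: p => x a w'0 ww' [/= /andP[a0 a1] awx].
have := ww' x; have := w'0 x; rewrite ler_norml => w'x /andP[ww'1 ww'2].
have e0 : 0 <= e by lra.
have [aw'|w'a] := leP a (w' x).
  exists (x, a); first by split=> //=; rewrite a0 a1.
  by rewrite /dbar /= mdistxx subrr normr0 maxxx.
exists (x, w' x); first by split=> //=; rewrite w'x; lra.
by rewrite /dbar /= mdistxx ge_max e0 ger0_norm; lra.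
Qed.

(** With [u x = 1] and [y] distinct from [x], either [u y < 1] and the value at
[y] can be raised by at most [e], or [u y = 1] and [u] can be truncated just
below 1 everywhere but at [x]. Truncation at [y] alone could destroy upper
semicontinuity. *)
Lemma perturb_endograph u (e : R) : ~ is_singleton [set: X] ->
    normal_fuzzy X u -> 0 < e ->
  exists v, [/\ normal_fuzzy X v, v <> u & (fuzzy_dE u v <= e%:E)%E].
Proof.
move=> X1 Fu e0; have /normal_fuzzyP[u01 uusc uco [x ux]] := Fu.
have u_ge0 z : 0 <= u z by have /andP[] := u01 z.
have u_le1 z : u z <= 1 by have /andP[] := u01 z.
have [y yx] : exists y, y != x.
  apply: contrapT => yN; apply: X1; exists x; apply/seteqP; split=> // y _.
  by apply/eqP; apply: contrapT => /negP yx; apply: yN; exists y.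
have finish v : normal_fuzzy X v -> v y <> u y ->
    (forall z, `|u z - v z| <= e) ->
    exists v, [/\ normal_fuzzy X v, v <> u & (fuzzy_dE u v <= e%:E)%E].
  move=> Fv vuy uv; exists v; split=> //; first by move=> vu; rewrite vu in vuy.
  apply: dE_le => // z.
  by have /normal_fuzzyP[/(_ z)/andP[]] := Fv.
have [uy|uy] := eqVneq (u y) 1.
(* The bound 1/2 keeps the truncation level positive when [e] is large, so
   that the support is unchanged. *)
- pose c : R := Num.max (1 / 2) (1 - e).
  have c0 : 1 / 2 <= c by rewrite le_max lexx.
  have ce : 1 - e <= c by rewrite le_max lexx orbT.
  have c1 : c < 1 by rewrite gt_max; lra.
  apply: (finish (raise (fun z => Num.min (u z) c) x 1)).
  + apply: normal_raise.
    * by move=> z; rewrite le_min ge_min u_ge0 u_le1; lra.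
    * move=> z a; rewrite gt_min => /orP[uza|ca].
        by apply: filterS (uusc z a uza) => t uta; rewrite gt_min uta.
      by near=> t; rewrite gt_min ca orbT.
    * by apply: compact_level0 uco _ => z; rewrite lt_min => /andP[].
    * by rewrite ge_min u_le1 lexx.
    * by exists x; rewrite raise_same.
  + by rewrite raise_other// uy /Num.min; case: ifP; lra.
  + move=> z; rewrite /raise; case: eqP => [->|_].
      by rewrite ux subrr normr0 ltW.
    have := u_le1 z; rewrite /Num.min; case: ifPn => [_ _|].
      by rewrite subrr normr0 ltW.
    by rewrite -leNgt => cu uz1; rewrite ger0_norm; lra.
- have uy1 : u y < 1 by rewrite lt_neqAle uy u_le1.
  pose c : R := Num.min 1 (u y + e).
  have c1 : c <= 1 by rewrite ge_min lexx.
  have ce : c <= u y + e by rewrite ge_min lexx orbT.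
  have cy : u y < c by rewrite lt_min uy1; lra.
  apply: (finish (raise u y c)).
  + apply: normal_raise => //; first by rewrite (ltW cy).
    by exists x; rewrite raise_other// eq_sym.
  + by rewrite raise_same => cuy; rewrite cuy ltxx in cy.
  + move=> z; rewrite /raise; case: eqP => [->|_].
      by rewrite distrC ger0_norm; lra.
    by rewrite subrr normr0 ltW.
Unshelve. all: by end_near. Qed.

(** * Singletons *)

Lemma singleton_compact_sets :
  is_singleton [set: X] -> is_singleton (compact_sets X).
Proof.
move=> [x Xx]; have xP z : z = x by have : [set: X] z by []; rewrite Xx.
exists [set x]; apply/seteqP; split=> [C [[c Cc] _]|_ ->] /=.
  by apply/seteqP; split=> z _; [exact: xP|rewrite (xP z) -(xP c)].
by split; [exists x|exact: compact_set1].
Qed.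

Lemma singleton_normal_fuzzy :
  is_singleton (compact_sets X) -> is_singleton (normal_fuzzy X).
Proof.
move=> [C KC]; have [[c _] _] : compact_sets X C by rewrite KC.
have setE z : [set z] = C.
  suff : compact_sets X [set z] by rewrite KC.
  by split; [exists z|exact: compact_set1].
have cP z : z = c by have : [set c] z by rewrite setE -(setE z).
exists (point c); apply/seteqP; split=> [v Fv|_ ->]; last exact: normal_point.
by apply: eq_point => // y _; exact: cP.
Qed.

Lemma normal_fuzzy_singleton :
  is_singleton (normal_fuzzy X) -> is_singleton [set: X].
Proof.
move=> [u Fu]; have pointE z : point z = u.
  by have := normal_point z; rewrite Fu.
have /normal_fuzzyP[_ _ _ [x _]] : normal_fuzzy X u by rewrite Fu.
exists x; apply/seteqP; split=> // y _; apply: point_gt0.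
by rewrite pointE -(pointE y) /point raise_same.
Qed.

End metric_space.
End isolated_points.

Theorem lemma2p6 (R : realType) (X : metricType R) :
  [/\ [<-> is_singleton [set: X];
           is_singleton (compact_sets X);
           is_singleton (normal_fuzzy X)],
      [<-> exists x : X, isolated [set: X] x;
           exists C : set X, isolated_in (compact_sets X) (@dH _ X) C;
           exists u : X -> R, isolated_in (normal_fuzzy X) fuzzy_dinfty u;
           exists u : X -> R, isolated_in (normal_fuzzy X) fuzzy_d0 u;
           exists u : X -> R, isolated_in (normal_fuzzy X) fuzzy_dS u] &
      ~ is_singleton [set: X] ->
        ~ exists u : X -> R, isolated_in (normal_fuzzy X) fuzzy_dE u].
Proof.
split.
- tfae.
  + exact: singleton_compact_sets.
  + exact: singleton_normal_fuzzy.
  + exact: normal_fuzzy_singleton.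
- have [Kl Kr] := exists_isolated_compact X.
  have [inftyl inftyr] := exists_isolated_dinfty X.
  have [d0l d0r] := exists_isolated_d0 X.
  have [dSl dSr] := exists_isolated_dS X.
  by tfae=> [/Kr|/Kl/inftyr|/inftyl/d0r|/d0l/dSr|/dSl].
- move=> X1 [u uiso]; have Fu := uiso.1; apply: not_isolated_in uiso => e.
  exact: perturb_endograph.
Qed.
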